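(* Let $\mathcal{A}:\mathbf{Causet}\to\mathbf{C^*Alg}$ be a $\mathrm{C}^*$-causal functor and let $K$ be a causal poset. For $o\in K$ let $(K|o):=\{a\in K : a\le o\}$ (with the order and causal disjointness relation inherited from $K$; it is a causal poset), let $\iota_o:(K|o)\to K$ be the inclusion morphism, and set $\mathcal{A}_o:=\mathcal{A}_{\iota_o}(\mathcal{A}(K|o))$. Then: (i) each $\mathcal{A}_o$ is a $\mathrm{C}^*$-subalgebra of $\mathcal{A}(K)$, $\mathcal{A}_o\subseteq\mathcal{A}_a$ whenever $o\le a$, and $(\mathcal{A},\mathrm{id})_K$ (the assignment $o\mapsto\mathcal{A}_o$ with the set-theoretic inclusions $\mathrm{id}_{ao}:\mathcal{A}_o\to\mathcal{A}_a$ as inclusion maps) is a causal net of $\mathrm{C}^*$-subalgebras of $\mathcal{A}(K)$; (ii) if $S$ is a symmetry group of $K$ and $\alpha_s:=\mathcal{A}_s$ for $s\in S$, then each $\alpha_s$ is a $^*$-automorphism of $\mathcal{A}(K)$ restricting to $^*$-isomorphisms $\mathcal{A}_o\to\mathcal{A}_{s(o)}$, and the net $(\mathcal{A},\mathrm{id},\alpha)_K$ is $S$-covariant.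
   Context: A poset $K$ (nonempty set with a partial order $\le$) is pathwise connected if for all $a,a'\in K$ there are $a_1=a,a_2,\dots,a_{n+1}=a'$ and $o_1,\dots,o_n$ in $K$ with $a_i,a_{i+1}\le o_i$ for all $i$. A causal disjointness relation on $K$ is an irreflexive symmetric binary relation $\perp$ such that $o\perp a$ and $\tilde o\le o$ imply $\tilde o\perp a$. A causal poset is a pathwise connected poset with a causal disjointness relation. A morphism $\psi:K\to K'$ of causal posets is an injective map with $a\le\tilde a\Rightarrow\psi(a)\le'\psi(\tilde a)$ and $o\perp\tilde o\Leftrightarrow\psi(o)\perp'\psi(\tilde o)$; $(K,K')$ denotes the set of morphisms, and $\mathbf{Causet}$ is the resulting category. A symmetry group of $K$ is a subgroup $S$ of the group of automorphisms of $K$ in $\mathbf{Causet}$. $\mathbf{C^*Alg}$ is the category of unital $\mathrm{C}^*$-algebras with unital injective $^*$-homomorphisms as arrows. A $\mathrm{C}^*$-causal functor is a functor $\mathcal{A}:\mathbf{Causet}\to\mathbf{C^*Alg}$ (written $K\mapsto\mathcal{A}(K)$, $\psi\mapsto\mathcal{A}_\psi$) such that whenever $\psi_i\in(K_i,K)$, $i=1,2$, and there are $o_1\perp o_2$ in $K$ with $\psi_i(a)\le o_i$ for all $a\in K_i$, then $\mathcal{A}_{\psi_1}(A)\mathcal{A}_{\psi_2}(B)=\mathcal{A}_{\psi_2}(B)\mathcal{A}_{\psi_1}(A)$ for all $A\in\mathcal{A}(K_1)$, $B\in\mathcal{A}(K_2)$. A net of $\mathrm{C}^*$-algebras over $K$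 is an assignment of unital $\mathrm{C}^*$-algebras $\mathcal{A}_o$, $o\in K$, and unital injective $^*$-homomorphisms $\jmath_{ao}:\mathcal{A}_o\to\mathcal{A}_a$ for $o\le a$ with $\jmath_{o''o'}\circ\jmath_{o'o}=\jmath_{o''o}$ for $o\le o'\le o''$. It is causal if $[\jmath_{ao_1}(\mathcal{A}_{o_1}),\jmath_{ao_2}(\mathcal{A}_{o_2})]=0$ whenever $o_1,o_2\le a$ and $o_1\perp o_2$. For a symmetry group $S$ of $K$ it is $S$-covariant if there are $^*$-isomorphisms $\alpha^o_g:\mathcal{A}_o\to\mathcal{A}_{g(o)}$, $o\in K$, $g\in S$, with $\alpha^{h(o)}_g\circ\alpha^o_h=\alpha^o_{gh}$ and $\alpha^a_g\circ\jmath_{ao}=\jmath_{g(a)g(o)}\circ\alpha^o_g$ for $o\le a$, $g,h\in S$ (here $\alpha^o_s$ is the restriction of $\alpha_s$ to $\mathcal{A}_o$). *)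

(* Defs.v *)
From Stdlib Require Import Reals Lia.
From Coquelicot Require Import Coquelicot.
Open Scope R_scope.

Record CausalPoset := {
  cp_car :> Type;
  cp_le : cp_car -> cp_car -> Prop;
  cp_perp : cp_car -> cp_car -> Prop;
  cp_inhabited : inhabited cp_car;
  cp_refl : forall a, cp_le a a;
  cp_trans : forall a b c, cp_le a b -> cp_le b c -> cp_le a c;
  cp_antisym : forall a b, cp_le a b -> cp_le b a -> a = b;
  cp_connected : forall a a' : cp_car, exists (n : nat) (as_ os : nat -> cp_car),
      as_ 0%nat = a /\ as_ n = a' /\
      (forall i, (i < n)%nat -> cp_le (as_ i) (os i) /\ cp_le (as_ (S i)) (os i));
  cp_irrefl : forall a, ~ cp_perp a a;
  cp_sym : forall a b, cp_perp a b -> cp_perp b a;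
  cp_down : forall o a o', cp_perp o a -> cp_le o' o -> cp_perp o' a
}.
Arguments cp_le {_} _ _.
Arguments cp_perp {_} _ _.

Record Morph (K K' : CausalPoset) := {
  mfun :> K -> K';
  m_inj : forall a b, mfun a = mfun b -> a = b;
  m_mono : forall a b, cp_le a b -> cp_le (mfun a) (mfun b);
  m_perp : forall o o', cp_perp o o' <-> cp_perp (mfun o) (mfun o')
}.
Arguments mfun {K K'} _ _.

Definition idm (K : CausalPoset) : Morph K K.
Proof.
  refine {| mfun := fun x => x |}; auto. intros; tauto.
Defined.

Definition compm {K1 K2 K3 : CausalPoset} (g : Morph K2 K3) (f : Morph K1 K2)
  : Morph K1 K3.
Proof.
  refine {| mfun := fun x => g (f x) |}.
  - intros a b H. apply (m_inj _ _ f), (m_inj _ _ g), H.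
  - intros a b H. apply (m_mono _ _ g), (m_mono _ _ f), H.
  - intros o o'. rewrite (m_perp _ _ f), (m_perp _ _ g). tauto.
Defined.

Definition sub_cp (K : CausalPoset) (o : K) : CausalPoset.
Proof.
  refine {| cp_car := {a : K | cp_le a o};
            cp_le := fun x y => cp_le (proj1_sig x) (proj1_sig y);
            cp_perp := fun x y => cp_perp (proj1_sig x) (proj1_sig y) |}.
  - constructor. exists o. apply cp_refl.
  - intros; apply cp_refl.
  - intros a b c; apply cp_trans.
  - intros [a Ha] [b Hb] H1 H2; simpl in *.
    assert (E : a = b) by (apply cp_antisym; auto). subst b.
    f_equal. apply Classical_Prop.proof_irrelevance.
  - intros a a'. exists 1%nat, (fun i => match i with 0%nat => a | _ => a' end),
      (fun _ => exist (fun b : K => cp_le b o) o (cp_refl K o)).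
    split; [reflexivity|split; [reflexivity|]]. intros j Hj. assert (j = 0%nat) by lia. subst j; simpl.
    split; [apply (proj2_sig a) | apply (proj2_sig a')].
  - intros a; apply cp_irrefl.
  - intros a b; apply cp_sym.
  - intros x a y; apply cp_down.
Defined.

Definition incl_m (K : CausalPoset) (o : K) : Morph (sub_cp K o) K.
Proof.
  refine {| mfun := fun x : sub_cp K o => proj1_sig x |}.
  - intros [a Ha] [b Hb] E; simpl in E; subst b.
    f_equal; apply Classical_Prop.proof_irrelevance.
  - auto.
  - intros; tauto.
Defined.

Record CStarAlg := {
  ca_car :> Type;
  ca_zero : ca_car; ca_one : ca_car;
  ca_add : ca_car -> ca_car -> ca_car;
  ca_opp : ca_car -> ca_car;
  ca_mul : ca_car -> ca_car -> ca_car;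
  ca_scal : C -> ca_car -> ca_car;
  ca_star : ca_car -> ca_car;
  ca_norm : ca_car -> R;
  ca_addA : forall x y z, ca_add x (ca_add y z) = ca_add (ca_add x y) z;
  ca_addC : forall x y, ca_add x y = ca_add y x;
  ca_add0 : forall x, ca_add ca_zero x = x;
  ca_addN : forall x, ca_add (ca_opp x) x = ca_zero;
  ca_scalDr : forall a x y, ca_scal a (ca_add x y) = ca_add (ca_scal a x) (ca_scal a y);
  ca_scalDl : forall a b x, ca_scal (Cplus a b) x = ca_add (ca_scal a x) (ca_scal b x);
  ca_scalA : forall a b x, ca_scal a (ca_scal b x) = ca_scal (Cmult a b) x;
  ca_scal1 : forall x, ca_scal (RtoC 1) x = x;
  ca_mulA : forall x y z, ca_mul x (ca_mul y z) = ca_mul (ca_mul x y) z;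
  ca_mul1l : forall x, ca_mul ca_one x = x;
  ca_mul1r : forall x, ca_mul x ca_one = x;
  ca_mulDl : forall x y z, ca_mul (ca_add x y) z = ca_add (ca_mul x z) (ca_mul y z);
  ca_mulDr : forall x y z, ca_mul x (ca_add y z) = ca_add (ca_mul x y) (ca_mul x z);
  ca_scalMl : forall a x y, ca_scal a (ca_mul x y) = ca_mul (ca_scal a x) y;
  ca_scalMr : forall a x y, ca_scal a (ca_mul x y) = ca_mul x (ca_scal a y);
  ca_starK : forall x, ca_star (ca_star x) = x;
  ca_starD : forall x y, ca_star (ca_add x y) = ca_add (ca_star x) (ca_star y);
  ca_starM : forall x y, ca_star (ca_mul x y) = ca_mul (ca_star y) (ca_star x);
  ca_starZ : forall a x, ca_star (ca_scal a x) = ca_scal (Cconj a) (ca_star x);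
  ca_norm_eq0 : forall x, ca_norm x = 0 -> x = ca_zero;
  ca_normD : forall x y, ca_norm (ca_add x y) <= ca_norm x + ca_norm y;
  ca_normZ : forall a x, ca_norm (ca_scal a x) = Cmod a * ca_norm x;
  ca_normM : forall x y, ca_norm (ca_mul x y) <= ca_norm x * ca_norm y;
  ca_Cstar : forall x, ca_norm (ca_mul (ca_star x) x) = ca_norm x ^ 2;
  ca_complete : forall u : nat -> ca_car,
      (forall eps, 0 < eps -> exists N, forall m n, (N <= m)%nat -> (N <= n)%nat ->
          ca_norm (ca_add (u m) (ca_opp (u n))) < eps) ->
      exists l, forall eps, 0 < eps -> exists N, forall n, (N <= n)%nat ->
          ca_norm (ca_add (u n) (ca_opp l)) < eps
}.
Arguments ca_one {_}. Arguments ca_add {_} _ _. Arguments ca_opp {_} _.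
Arguments ca_mul {_} _ _. Arguments ca_scal {_} _ _. Arguments ca_star {_} _.
Arguments ca_norm {_} _.

Definition is_CStar_arrow (A B : CStarAlg) (f : A -> B) : Prop :=
  (forall x y, f (ca_add x y) = ca_add (f x) (f y)) /\
  (forall x y, f (ca_mul x y) = ca_mul (f x) (f y)) /\
  (forall a x, f (ca_scal a x) = ca_scal a (f x)) /\
  (forall x, f (ca_star x) = ca_star (f x)) /\
  f ca_one = ca_one /\
  (forall x y, f x = f y -> x = y).

Definition is_star_automorphism (A : CStarAlg) (f : A -> A) : Prop :=
  (forall x y, f (ca_add x y) = ca_add (f x) (f y)) /\
  (forall x y, f (ca_mul x y) = ca_mul (f x) (f y)) /\
  (forall a x, f (ca_scal a x) = ca_scal a (f x)) /\
  (forall x, f (ca_star x) = ca_star (f x)) /\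
  (forall x y, f x = f y -> x = y) /\
  (forall y, exists x, f x = y).

Definition ca_converges (A : CStarAlg) (u : nat -> A) (l : A) : Prop :=
  forall eps, 0 < eps -> exists N, forall n, (N <= n)%nat ->
    ca_norm (ca_add (u n) (ca_opp l)) < eps.

Definition is_CStar_subalgebra (A : CStarAlg) (B : A -> Prop) : Prop :=
  B ca_one /\
  (forall x y, B x -> B y -> B (ca_add x y)) /\
  (forall x y, B x -> B y -> B (ca_mul x y)) /\
  (forall a x, B x -> B (ca_scal a x)) /\
  (forall x, B x -> B (ca_star x)) /\
  (forall u l, (forall n, B (u n)) -> ca_converges A u l -> B l).

Record CausalFunctor := {
  F_obj :> CausalPoset -> CStarAlg;
  F_mor : forall K K' : CausalPoset, Morph K K' -> F_obj K -> F_obj K';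
  F_arrow : forall K K' (psi : Morph K K'), is_CStar_arrow _ _ (F_mor K K' psi);
  F_id : forall K x, F_mor K K (idm K) x = x;
  F_comp : forall K1 K2 K3 (g : Morph K2 K3) (f : Morph K1 K2) x,
      F_mor K1 K3 (compm g f) x = F_mor K2 K3 g (F_mor K1 K2 f x);
  F_causal : forall K K1 K2 (psi1 : Morph K1 K) (psi2 : Morph K2 K) (o1 o2 : K),
      cp_perp o1 o2 ->
      (forall a, cp_le (psi1 a) o1) -> (forall a, cp_le (psi2 a) o2) ->
      forall (x : F_obj K1) (y : F_obj K2),
        ca_mul (F_mor K1 K psi1 x) (F_mor K2 K psi2 y) =
        ca_mul (F_mor K2 K psi2 y) (F_mor K1 K psi1 x)
}.
Arguments F_mor _ {K K'} _ _.

Definition local_alg (F : CausalFunctor) (K : CausalPoset) (o : K) : F K -> Prop :=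
  fun x => exists y : F (sub_cp K o), F_mor F (incl_m K o) y = x.

(* Causal net of C*-subalgebras of A with inclusion maps (the identities):
   the compatibility j_{o''o'} o j_{o'o} = j_{o''o} is then automatic. *)
Definition causal_subnet (K : CausalPoset) (A : CStarAlg) (N : K -> A -> Prop) : Prop :=
  (forall o, is_CStar_subalgebra A (N o)) /\
  (forall o a, cp_le o a -> forall x, N o x -> N a x) /\
  (forall o1 o2 a, cp_le o1 a -> cp_le o2 a -> cp_perp o1 o2 ->
     forall x y, N o1 x -> N o2 y -> ca_mul x y = ca_mul y x).

Definition is_cp_automorphism (K : CausalPoset) (s : Morph K K) : Prop :=
  exists t : Morph K K, (forall x, s (t x) = x) /\ (forall x, t (s x) = x).

Definition symmetry_group (K : CausalPoset) (S : Morph K K -> Prop) : Prop :=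
  (forall s, S s -> is_cp_automorphism K s) /\
  S (idm K) /\
  (forall g h, S g -> S h -> S (compm g h)) /\
  (forall s, S s -> exists t, S t /\ (forall x, s (t x) = x) /\ (forall x, t (s x) = x)).

(* Main.v *)
(* The only analytic point is that each local algebra is norm closed, which
   holds because an injective unital *-homomorphism f is isometric.  This is
   proved without spectral theory, from square roots c of 1 - b for self-adjoint
   b with |b| <= 1.
   For self-adjoint a with |a| <= 1, a + i sqrt(1 - a^2) is unitary, hence so is
   its image, and |f a| <= 1.  Conversely, if |f a| <= 1, then 1 - (f a)^2 is a
   square in the target; uniqueness of positive square roots and injectivity
   pull this back to 1 - a^2 = r^2 up to scaling, whence |a| <= 1.
   Everything else is functoriality applied to restrictions of morphisms to
   the posets (K|o). *)
Require Import Defs.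
From Stdlib Require Import Reals Lra Lia Ncring Ncring_tac FunctionalExtensionality ClassicalEpsilon.
From Coquelicot Require Import Coquelicot.

(** * Notation and the noncommutative ring underlying a C*-algebra *)

Arguments ca_zero {_}.

Declare Scope ca_scope.
Delimit Scope ca_scope with ca.
Local Notation "0" := ca_zero : ca_scope.
Local Notation "1" := ca_one : ca_scope.
Local Notation "x + y" := (ca_add x y) : ca_scope.
Local Notation "- x" := (ca_opp x) : ca_scope.
Local Notation "x - y" := (ca_add x (ca_opp y)) : ca_scope.
Local Notation "x * y" := (ca_mul x y) : ca_scope.
Local Notation "r *: x" := (ca_scal (RtoC r) x) (at level 40, left associativity) : ca_scope.
Local Notation "'norm' x" := (ca_norm x%ca) (at level 10, x at level 9).
Bind Scope ca_scope with ca_car.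
Local Open Scope ca_scope.

#[local] Instance ca_ring_ops (A : CStarAlg) :
  @Ring_ops A ca_zero ca_one ca_add ca_mul (fun x y => x - y) ca_opp eq := {}.

#[local] Instance ca_ring (A : CStarAlg) : @Ncring.Ring A _ _ _ _ _ _ _ (ca_ring_ops A).
Proof.
split.
- exact eq_equivalence.
- intros ? ? -> ? ? ->; reflexivity.
- intros ? ? -> ? ? ->; reflexivity.
- intros ? ? -> ? ? ->; reflexivity.
- intros ? ? ->; reflexivity.
- exact (ca_add0 A).
- exact (ca_addC A).
- exact (ca_addA A).
- exact (ca_mul1l A).
- exact (ca_mul1r A).
- exact (ca_mulA A).
- exact (ca_mulDl A).
- exact (fun x y z => ca_mulDr A z x y).
- reflexivity.
- intros x. exact (eq_trans (ca_addC A _ _) (ca_addN A x)).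
Qed.

(** * Scalars, involution and norm *)

Section Algebra.
Variable A : CStarAlg.
Implicit Types x y z : A.

Lemma sub_eq0 x y : x - y = 0 -> x = y.
Proof.
intros E. transitivity ((x - y) + y); [non_commutative_ring | rewrite E; non_commutative_ring].
Qed.

Lemma scal_zero_l x : 0%R *: x = 0.
Proof.
assert (E : 0%R *: x = 0%R *: x + 0%R *: x).
{ rewrite <- ca_scalDl. f_equal. unfold Cplus, RtoC; simpl; f_equal; ring. }
transitivity (0%R *: x + 0%R *: x - 0%R *: x); [non_commutative_ring|].
rewrite <- E. non_commutative_ring.
Qed.

Lemma opp_scal x : - x = (-1)%R *: x.
Proof.
assert (E : (-1)%R *: x + x = 0).
{ rewrite <- (ca_scal1 A x) at 2. rewrite <- ca_scalDl, <- (scal_zero_l x).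
  f_equal. unfold Cplus, RtoC; simpl; f_equal; ring. }
transitivity (- x + ((-1)%R *: x + x)); [rewrite E|]; non_commutative_ring.
Qed.

Lemma scalRA (r s : R) x : r *: (s *: x) = (r * s)%R *: x.
Proof. rewrite ca_scalA; f_equal. unfold Cmult, RtoC; simpl; f_equal; ring. Qed.

Lemma scalRDl (r s : R) x : (r + s)%R *: x = r *: x + s *: x.
Proof. rewrite <- ca_scalDl; f_equal. unfold Cplus, RtoC; simpl; f_equal; ring. Qed.

Lemma scal_opp (a : C) x : ca_scal a (- x) = - ca_scal a x.
Proof. rewrite !opp_scal, !ca_scalA. f_equal; apply Cmult_comm. Qed.

Lemma scalR_star (r : R) x : ca_star (r *: x) = r *: ca_star x.
Proof. rewrite ca_starZ; f_equal. unfold Cconj, RtoC; simpl; f_equal; ring. Qed.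

Lemma scalR_mul (r s : R) x y : (r *: x) * (s *: y) = (r * s)%R *: (x * y).
Proof. rewrite <- ca_scalMl, <- ca_scalMr; apply scalRA. Qed.

Lemma half_double x : (/ 2)%R *: (x + x) = x.
Proof.
rewrite ca_scalDr, <- scalRDl. rewrite <- (ca_scal1 A x) at 2. repeat f_equal; field.
Qed.

Lemma star_opp x : ca_star (- x) = - ca_star x.
Proof. now rewrite !opp_scal, scalR_star. Qed.

Lemma star_one : ca_star (1 : A) = 1.
Proof.
rewrite <- (ca_mul1l A (ca_star 1)). rewrite <- (ca_starK A 1) at 1.
now rewrite <- ca_starM, ca_mul1l, ca_starK.
Qed.

Lemma norm_scalR (r : R) x : norm (r *: x) = (Rabs r * norm x)%R.
Proof. now rewrite ca_normZ, Cmod_R. Qed.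

Lemma norm_zero : norm (0 : A) = 0%R.
Proof. rewrite <- (scal_zero_l 0), norm_scalR, Rabs_R0; ring. Qed.

Lemma norm_opp x : norm (- x) = norm x.
Proof. rewrite opp_scal, norm_scalR, Rabs_left by lra; ring. Qed.

(** Positivity is not an axiom of [CStarAlg]; it follows from [0 = norm (x - x) <= 2 * norm x]. *)
Lemma norm_ge0 x : (0 <= norm x)%R.
Proof.
pose proof (ca_normD A x (- x)) as H. rewrite norm_opp in H.
replace (x - x) with (0 : A) in H by non_commutative_ring. rewrite norm_zero in H; lra.
Qed.

Lemma norm_subC x y : norm (x - y) = norm (y - x).
Proof. rewrite <- norm_opp; f_equal; non_commutative_ring. Qed.

(** The C*-identity and submultiplicativity give |y|^2 <= |y*| |y|; cancel |y|, then exchange y and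
    y*. *)
Lemma norm_star x : norm (ca_star x) = norm x.
Proof.
assert (H : forall y, (norm y <= norm (ca_star y))%R).
{ intros y. pose proof (ca_Cstar A y) as E. pose proof (ca_normM A (ca_star y) y) as M.
  pose proof (norm_ge0 y) as P. pose proof (norm_ge0 (ca_star y)).
  destruct (Req_dec (norm y) 0); [lra|]. rewrite E in M. nra. }
apply Rle_antisym; [rewrite <- (ca_starK A x) at 2|]; apply H.
Qed.

(** The C*-identity gives |1| = |1|^2. Equality with 1 fails in the zero algebra, which the axioms
    admit. *)
Lemma norm_one_le1 : (norm (1 : A) <= 1)%R.
Proof.
pose proof (ca_Cstar A 1) as E. rewrite star_one, ca_mul1l in E.
pose proof (norm_ge0 1). nra.
Qed.

(** * Positivity expressed through sums of squares *)

Lemma star_mul_self_eq0 x : ca_star x * x = 0 -> x = 0.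
Proof.
intros E. apply ca_norm_eq0. pose proof (ca_Cstar A x) as N.
rewrite E, norm_zero in N. pose proof (norm_ge0 x). nra.
Qed.

(* With u = x + iy one has u* u = x^2 + y^2, while x = (u + u* )/2. *)
Lemma norm_sq_le_sum_squares x y :
  ca_star x = x -> ca_star y = y -> x * y = y * x ->
  (norm x ^ 2 <= norm (x * x + y * y))%R.
Proof.
intros Sx Sy Cxy.
set (w := ca_scal Ci y). set (u := x + w).
assert (Su : ca_star u = x - w).
{ unfold u, w. rewrite ca_starD, ca_starZ, Sx, Sy, opp_scal, ca_scalA. do 2 f_equal.
  unfold Cconj, Ci, Cmult, RtoC; simpl; f_equal; ring. }
assert (Cxw : x * w = w * x).
{ unfold w. now rewrite <- ca_scalMr, <- ca_scalMl, Cxy. }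
assert (Ww : w * w = - (y * y)).
{ unfold w. rewrite <- ca_scalMr, <- ca_scalMl, ca_scalA, opp_scal. f_equal.
  unfold Ci, Cmult, RtoC; simpl; f_equal; ring. }
assert (E : ca_star u * u = x * x + y * y).
{ rewrite Su. unfold u. transitivity (x * x + x * w - w * x - w * w); [non_commutative_ring|].
  rewrite Cxw, Ww; non_commutative_ring. }
rewrite <- E, ca_Cstar. apply pow_incr. split; [apply norm_ge0|].
replace x with ((/ 2)%R *: (u + ca_star u)).
2:{ rewrite <- (half_double x). f_equal. rewrite Su. unfold u. non_commutative_ring. }
rewrite norm_scalR, Rabs_pos_eq by lra.
pose proof (ca_normD A u (ca_star u)) as H. rewrite norm_star in H. lra.
Qed.

Lemma sum_squares_eq0 x y :
  ca_star x = x -> ca_star y = y -> x * y = y * x -> x * x + y * y = 0 -> x = 0.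
Proof.
intros Sx Sy Cxy E. apply ca_norm_eq0.
pose proof (norm_sq_le_sum_squares x y Sx Sy Cxy) as H.
rewrite E, norm_zero in H. pose proof (norm_ge0 x). nra.
Qed.

Lemma comm_square x y : x * y = y * x -> x * (y * y) = (y * y) * x.
Proof. intros H. now rewrite ca_mulA, H, <- ca_mulA, H, ca_mulA. Qed.

(* Uniqueness of positive square roots for positives presented as squares: the
   difference d of the two squares satisfies (d r)^2 + (d q)^2 = 0. *)
Lemma square_inj_on_squares (r q : A) :
  ca_star r = r -> ca_star q = q -> r * q = q * r ->
  (r * r) * (r * r) = (q * q) * (q * q) -> r * r = q * q.
Proof.
intros Sr Sq Crq E.
set (d := r * r - q * q).
assert (Cqr2 : q * (r * r) = (r * r) * q) by now apply comm_square.
assert (Crq2 : r * (q * q) = (q * q) * r) by now apply comm_square.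
assert (Cdr : d * r = r * d).
{ unfold d. rewrite ca_mulDr. transitivity (r * (r * r) - (q * q) * r); [non_commutative_ring|].
  rewrite <- Crq2; non_commutative_ring. }
assert (Cdq : d * q = q * d).
{ unfold d. rewrite ca_mulDr. transitivity ((r * r) * q - q * (q * q)); [non_commutative_ring|].
  rewrite <- Cqr2; non_commutative_ring. }
assert (Sd : ca_star d = d).
{ unfold d. now rewrite ca_starD, star_opp, !ca_starM, Sr, Sq. }
assert (Sdr : ca_star (d * r) = d * r) by now rewrite ca_starM, Sd, Sr.
assert (Sdq : ca_star (d * q) = d * q) by now rewrite ca_starM, Sd, Sq.
assert (Cc : (d * r) * (d * q) = (d * q) * (d * r)).
{ transitivity (d * ((r * d) * q)); [non_commutative_ring|]. rewrite <- Cdr.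
  transitivity (d * (d * (r * q))); [non_commutative_ring|]. rewrite Crq.
  transitivity (d * ((d * q) * r)); [non_commutative_ring|]. rewrite Cdq at 1.
  non_commutative_ring. }
(* This product is r^4 - q^4, because r^2 and q^2 commute. *)
assert (D2 : d * (r * r + q * q) = 0).
{ assert (C2 : (r * r) * (q * q) = (q * q) * (r * r))
    by now rewrite <- ca_mulA, Crq2, ca_mulA, Crq2, <- ca_mulA.
  unfold d. transitivity ((r * r) * (r * r) + (r * r) * (q * q) - (q * q) * (r * r) - (q * q) * (q * q)).
  - non_commutative_ring.
  - rewrite E, C2. non_commutative_ring. }
assert (Z : (d * r) * (d * r) + (d * q) * (d * q) = 0).
{ transitivity (d * ((r * d) * r) + d * ((q * d) * q)); [non_commutative_ring|].
  rewrite <- Cdr, <- Cdq. transitivity (d * (d * (r * r + q * q))); [non_commutative_ring|].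
  rewrite D2; non_commutative_ring. }
assert (Z1 : d * r = 0) by exact (sum_squares_eq0 _ _ Sdr Sdq Cc Z).
assert (Z2 : d * q = 0).
{ apply (sum_squares_eq0 _ (d * r) Sdq Sdr (eq_sym Cc)). now rewrite ca_addC. }
(* Since d is self-adjoint, d* d = d^2 = (d r) r - (d q) q, and both terms vanish. *)
apply sub_eq0. fold d. apply star_mul_self_eq0. rewrite Sd. unfold d at 2.
transitivity ((d * r) * r - (d * q) * q); [non_commutative_ring|].
rewrite Z1, Z2; non_commutative_ring.
Qed.

(** * Norm convergence and continuity of the operations *)

Lemma ca_convergesE (u : nat -> A) l :
  ca_converges A u l <-> is_lim_seq (fun n => norm (u n - l)) 0%R.
Proof.
rewrite <- is_lim_seq_spec. split.
- intros H eps. destruct (H eps (cond_pos eps)) as [N HN]. exists N. intros n Hn.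
  specialize (HN n Hn). rewrite Rminus_0_r, Rabs_pos_eq; [exact HN | apply norm_ge0].
- intros H eps He. destruct (H (mkposreal eps He)) as [N HN]. exists N. intros n Hn.
  specialize (HN n Hn). rewrite Rminus_0_r, Rabs_pos_eq in HN; [exact HN | apply norm_ge0].
Qed.

(** Common source of the continuity statements: each operation below satisfies such a Lipschitz
    bound. *)
Lemma converges_of_le (u : nat -> A) l (v : nat -> A) m (M : R) :
  (forall n, (norm (v n - m) <= M * norm (u n - l))%R) ->
  ca_converges A u l -> ca_converges A v m.
Proof.
rewrite !ca_convergesE. intros B H.
apply (is_lim_seq_le_le (fun _ => 0%R) _ (fun n => M * norm (u n - l))%R).
- intros n; split; [apply norm_ge0 | apply B].
- apply is_lim_seq_const.
- replace (Finite 0) with (Rbar_mult M 0%R) by (simpl; f_equal; ring).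
  now apply is_lim_seq_scal_l.
Qed.

Lemma converges_unique (u : nat -> A) l m :
  ca_converges A u l -> ca_converges A u m -> l = m.
Proof.
rewrite !ca_convergesE. intros H1 H2.
apply sub_eq0, ca_norm_eq0, Rle_antisym; [|apply norm_ge0].
pose proof (is_lim_seq_plus' _ _ _ _ H1 H2) as H. rewrite Rplus_0_r in H.
refine (is_lim_seq_le (fun _ => norm (l - m)) _ (norm (l - m)) 0%R _ _ H);
  [|apply is_lim_seq_const].
intros n; simpl. rewrite (norm_subC (u n) l).
replace (l - m) with ((l - u n) + (u n - m)) by non_commutative_ring. apply ca_normD.
Qed.

Lemma converges_mul_l z (u : nat -> A) l :
  ca_converges A u l -> ca_converges A (fun n => z * u n) (z * l).
Proof.
apply converges_of_le with (norm z). intros n.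
replace (z * u n - z * l) with (z * (u n - l)) by non_commutative_ring. apply ca_normM.
Qed.

Lemma converges_mul_r z (u : nat -> A) l :
  ca_converges A u l -> ca_converges A (fun n => u n * z) (l * z).
Proof.
apply converges_of_le with (norm z). intros n.
replace (u n * z - l * z) with ((u n - l) * z) by non_commutative_ring.
rewrite Rmult_comm; apply ca_normM.
Qed.

Lemma converges_star (u : nat -> A) l :
  ca_converges A u l -> ca_converges A (fun n => ca_star (u n)) (ca_star l).
Proof.
apply converges_of_le with 1%R. intros n.
rewrite <- star_opp, <- ca_starD, norm_star. lra.
Qed.

Lemma converges_norm_le (u : nat -> A) l (M : R) :
  (forall n, (norm (u n) <= M)%R) -> ca_converges A u l -> (norm l <= M)%R.
Proof.
rewrite ca_convergesE. intros B H.
pose proof (is_lim_seq_plus' _ _ _ _ (is_lim_seq_const M) H) as H'. rewrite Rplus_0_r in H'.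
refine (is_lim_seq_le (fun _ => norm l) _ (norm l) M _ _ H'); [|apply is_lim_seq_const].
intros n; simpl. specialize (B n). rewrite norm_subC.
pose proof (ca_normD A (u n) (l - u n)) as T.
replace (u n + (l - u n)) with l in T by non_commutative_ring. lra.
Qed.

(** The splitting x^2 - y^2 = x (x - y) + (x - y) y holds for noncommuting x and y. *)
Lemma norm_sub_squares x y :
  (norm (x * x - y * y) <= (norm x + norm y) * norm (x - y))%R.
Proof.
replace (x * x - y * y) with (x * (x - y) + (x - y) * y) by non_commutative_ring.
pose proof (ca_normD A (x * (x - y)) ((x - y) * y)).
pose proof (ca_normM A x (x - y)). pose proof (ca_normM A (x - y) y). lra.
Qed.

End Algebra.

(** * Square roots of 1 - b by monotone majorisation *)

(* Fixed points y = (b + y^2)/2 are exactly those with (1 - y)^2 = 1 - b. *)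
Fixpoint sqrt_iter (A : CStarAlg) (b : A) (n : nat) : A :=
  match n with
  | O => 0
  | S n => (/ 2)%R *: (b + sqrt_iter A b n * sqrt_iter A b n)
  end.

(** The same recursion in the reals at b = 1, the extreme case allowed by |b| <= 1. It majorises the
    norms and the increments of [sqrt_iter]. *)
Fixpoint sqrt_bound (n : nat) : R :=
  match n with
  | O => 0%R
  | S n => ((1 + sqrt_bound n * sqrt_bound n) / 2)%R
  end.

Lemma sqrt_bound_itv n : (0 <= sqrt_bound n <= 1)%R.
Proof. induction n as [|n IH]; simpl; nra. Qed.

Lemma sqrt_bound_growing : Un_growing sqrt_bound.
Proof. intros n; simpl. pose proof (sqrt_bound_itv n); nra. Qed.

Lemma sqrt_bound_cauchy : Cauchy_crit sqrt_bound.
Proof.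
apply CV_Cauchy. destruct (growing_cv sqrt_bound) as [l Hl].
- exact sqrt_bound_growing.
- exists 1%R. intros x [n ->]. apply sqrt_bound_itv.
- now exists l.
Qed.

Section SqrtIter.
Variables (A : CStarAlg) (b : A).
Hypothesis b_le1 : (norm b <= 1)%R.
Let y := sqrt_iter A b.

Lemma sqrt_iter_norm n : (norm (y n) <= sqrt_bound n)%R.
Proof.
induction n as [|n IH]; [unfold y; simpl; rewrite norm_zero; lra|].
unfold y in *; simpl. rewrite norm_scalR, Rabs_pos_eq by lra.
set (v := sqrt_iter A b n) in *.
pose proof (ca_normD A b (v * v)). pose proof (ca_normM A v v). pose proof (norm_ge0 A v). nra.
Qed.

(** With s for [sqrt_bound], [norm_sub_squares] bounds the next increment by (s(n+1) + s(n)) (s(n+1)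
    - s(n)) / 2, which is s(n+2) - s(n+1). These bounds telescope, so convergence of the scalar
    sequence makes [y] Cauchy. *)
Lemma sqrt_iter_step n : (norm (y (S n) - y n) <= sqrt_bound (S n) - sqrt_bound n)%R.
Proof.
induction n as [|n IH].
- simpl. replace (y 1 - y 0) with (y 1) by (unfold y; simpl; non_commutative_ring).
  pose proof (sqrt_iter_norm 1) as H. simpl in H. lra.
- change (sqrt_bound (S (S n))) with ((1 + sqrt_bound (S n) * sqrt_bound (S n)) / 2)%R.
  change (sqrt_bound (S n)) with ((1 + sqrt_bound n * sqrt_bound n) / 2)%R at 3.
  replace (y (S (S n)) - y (S n)) with ((/ 2)%R *: (y (S n) * y (S n) - y n * y n)).
  2:{ change (y (S (S n)) - y (S n)) with
        ((/ 2)%R *: (b + y (S n) * y (S n)) - (/ 2)%R *: (b + y n * y n)).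
      rewrite <- scal_opp, <- ca_scalDr. f_equal. non_commutative_ring. }
  rewrite norm_scalR, Rabs_pos_eq by lra.
  pose proof (norm_sub_squares A (y (S n)) (y n)).
  pose proof (sqrt_iter_norm (S n)). pose proof (sqrt_iter_norm n).
  pose proof (norm_ge0 A (y (S n))). pose proof (norm_ge0 A (y n)).
  pose proof (norm_ge0 A (y (S n) - y n)). nra.
Qed.

Lemma sqrt_iter_diff n k : (norm (y (n + k) - y n) <= sqrt_bound (n + k) - sqrt_bound n)%R.
Proof.
induction k as [|k IH].
- rewrite Nat.add_0_r. replace (y n - y n) with (0 : A) by non_commutative_ring.
  rewrite norm_zero; lra.
- rewrite Nat.add_succ_r.
  replace (y (S (n + k)) - y n) with ((y (S (n + k)) - y (n + k)%nat) + (y (n + k)%nat - y n))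
    by non_commutative_ring.
  pose proof (ca_normD A (y (S (n + k)) - y (n + k)%nat) (y (n + k)%nat - y n)).
  pose proof (sqrt_iter_step (n + k)). lra.
Qed.

Lemma sqrt_iter_dist m n : (norm (y m - y n) <= Rabs (sqrt_bound m - sqrt_bound n))%R.
Proof.
destruct (Nat.le_ge_cases n m) as [H|H].
- replace m with (n + (m - n))%nat by lia.
  eapply Rle_trans; [apply sqrt_iter_diff | apply Rle_abs].
- rewrite norm_subC, Rabs_minus_sym. replace n with (m + (n - m))%nat by lia.
  eapply Rle_trans; [apply sqrt_iter_diff | apply Rle_abs].
Qed.

Lemma sqrt_iter_converges : exists l, ca_converges A y l.
Proof.
apply (ca_complete A y). intros eps He.
destruct (sqrt_bound_cauchy eps He) as [N HN]. exists N. intros m n Hm Hn.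
eapply Rle_lt_trans; [apply sqrt_iter_dist | apply HN; assumption].
Qed.

Lemma sqrt_iter_star : ca_star b = b -> forall n, ca_star (y n) = y n.
Proof.
intros Sb n. induction n as [|n IH]; unfold y in *; simpl.
- now rewrite <- (scal_zero_l A 0), scalR_star, !scal_zero_l.
- now rewrite scalR_star, ca_starD, ca_starM, Sb, IH.
Qed.

Lemma sqrt_iter_comm z : z * b = b * z -> forall n, z * y n = y n * z.
Proof.
intros Hz n. induction n as [|n IH]; unfold y in *; simpl; [non_commutative_ring|].
rewrite <- ca_scalMl, <- ca_scalMr. f_equal. rewrite ca_mulDr, ca_mulDl, Hz. f_equal.
now rewrite ca_mulA, IH, <- ca_mulA, IH, ca_mulA.
Qed.

End SqrtIter.

(** The root is c = 1 - l with l the limit of the iteration. The bound on 1 - c allows the lemma to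
    be applied again with b := 1 - c, giving a square root of c. The last clause replaces membership
    of c in the closed algebra generated by b. *)
Lemma exists_sqrt_one_sub (A : CStarAlg) (b : A) :
  ca_star b = b -> (norm b <= 1)%R ->
  exists c : A, ca_star c = c /\ c * c = 1 - b /\ (norm (1 - c) <= 1)%R /\
    forall z, z * b = b * z -> z * c = c * z.
Proof.
intros Sb Nb. destruct (sqrt_iter_converges A b Nb) as [l Hl].
assert (Ny : forall n, (norm (sqrt_iter A b n) <= 1)%R).
{ intros n. eapply Rle_trans; [now apply sqrt_iter_norm | apply sqrt_bound_itv]. }
assert (Sl : ca_star l = l).
{ apply (converges_unique A (sqrt_iter A b)); [|exact Hl].
  refine (converges_of_le A _ _ _ _ 1 _ (converges_star A _ _ Hl)).
  intros n. rewrite (sqrt_iter_star A b Sb). lra. }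
assert (Cl : forall z, z * b = b * z -> z * l = l * z).
{ intros z Hz. apply (converges_unique A (fun n => z * sqrt_iter A b n));
    [now apply converges_mul_l|].
  refine (converges_of_le A _ _ _ _ 1 _ (converges_mul_r A z _ _ Hl)).
  intros n. rewrite (sqrt_iter_comm A b z Hz). lra. }
assert (Fl : l = (/ 2)%R *: (b + l * l)).
{ apply (converges_unique A (fun n => sqrt_iter A b (S n))).
  (* The shifted sequence keeps the limit [l]; the other bullet shows that it also tends to the
     right-hand side. *)
  - intros eps He. destruct (Hl eps He) as [N HN]. exists N. intros n Hn. apply HN; lia.
  (* The constant is half the factor |v| + |l| of [norm_sub_squares], with |v| <= 1. *)
  - refine (converges_of_le A _ _ _ _ ((1 + norm l) / 2) _ Hl). intros n. simpl.
    rewrite <- scal_opp, <- ca_scalDr, norm_scalR, Rabs_pos_eq by lra.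
    set (v := sqrt_iter A b n).
    replace (b + v * v - (b + l * l)) with (v * v - l * l) by non_commutative_ring.
    pose proof (norm_sub_squares A v l). pose proof (Ny n : (norm v <= 1)%R).
    pose proof (norm_ge0 A (v - l)). nra. }
assert (Dl : l + l = b + l * l).
{ rewrite <- (half_double A (b + l * l)), ca_scalDr, <- Fl. reflexivity. }
exists (1 - l). repeat split.
- now rewrite ca_starD, star_opp, star_one, Sl.
- transitivity (1 - (l + l) + l * l); [non_commutative_ring|].
  rewrite Dl; non_commutative_ring.
- replace (1 - (1 - l)) with l by non_commutative_ring.
  exact (converges_norm_le A _ _ _ Ny Hl).
- intros z Hz. transitivity (z - z * l); [non_commutative_ring|].
  rewrite (Cl z Hz); non_commutative_ring.
Qed.

Lemma comm_one_sub (A : CStarAlg) (x y : A) : x * y = y * x -> x * (1 - y) = (1 - y) * x.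
Proof.
intros H. transitivity (x - x * y); [non_commutative_ring | rewrite H; non_commutative_ring].
Qed.

Lemma star_square (A : CStarAlg) (x : A) : ca_star x = x -> ca_star (x * x) = x * x.
Proof. intros H. now rewrite ca_starM, H. Qed.

Lemma norm_square_le1 (A : CStarAlg) (x : A) : (norm x <= 1)%R -> (norm (x * x) <= 1)%R.
Proof. intros H. pose proof (ca_normM A x x). pose proof (norm_ge0 A x). nra. Qed.

(** * Injective unital *-homomorphisms are isometric with closed range *)

Section Isometry.
Variables (A B : CStarAlg) (f : A -> B).
Hypothesis Hf : is_CStar_arrow A B f.

Let fD : forall x y, f (x + y) = f x + f y := proj1 Hf.
Let fM : forall x y, f (x * y) = f x * f y := proj1 (proj2 Hf).
Let fZ : forall a x, f (ca_scal a x) = ca_scal a (f x) := proj1 (proj2 (proj2 Hf)).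
Let fS : forall x, f (ca_star x) = ca_star (f x) := proj1 (proj2 (proj2 (proj2 Hf))).
Let f1 : f 1 = 1 := proj1 (proj2 (proj2 (proj2 (proj2 Hf)))).
Let fI : forall x y, f x = f y -> x = y := proj2 (proj2 (proj2 (proj2 (proj2 Hf)))).

Lemma arrow_opp x : f (- x) = - f x.
Proof. now rewrite !opp_scal, fZ. Qed.

(** For c^2 = 1 - a^2 commuting with a, the images satisfy (f a)^2 + (f c)^2 = f 1 = 1, which bounds
    |f a|. *)
Lemma selfadjoint_arrow_le1 a : ca_star a = a -> (norm a <= 1)%R -> (norm (f a) <= 1)%R.
Proof.
intros Sa Na.
destruct (exists_sqrt_one_sub A (a * a)) as (c & Sc & Ec & _ & Cc);
  [now apply star_square | now apply norm_square_le1|].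
assert (H : (norm (f a) ^ 2 <= norm (f a * f a + f c * f c))%R).
{ apply norm_sq_le_sum_squares.
  - now rewrite <- fS, Sa.
  - now rewrite <- fS, Sc.
  - rewrite <- !fM. f_equal. apply Cc. now apply comm_square. }
rewrite <- !fM, <- fD, Ec in H.
replace (a * a + (1 - a * a)) with (1 : A) in H by non_commutative_ring.
rewrite f1 in H. pose proof (norm_one_le1 B). pose proof (norm_ge0 B (f a)). nra.
Qed.

(* Injectivity enters through t = s (a^2 - 1) and its absolute value p: as
   f t <= 0 one gets f (p + t) = 0, so p = -t, i.e. 1 - a^2 is positive in A. *)
Lemma selfadjoint_le1_of_arrow a : ca_star a = a -> (norm (f a) <= 1)%R -> (norm a <= 1)%R.
Proof.
intros Sa Na.
assert (Hs : exists s : R, (0 < s)%R /\ (norm ((s * s)%R *: (a * a - 1)) <= 1)%R).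
{ set (M := norm (a * a - 1)). pose proof (norm_ge0 A (a * a - 1) : (0 <= M)%R).
  (* As s <= 1 and s M <= 1, also s^2 M <= 1. The factor is a square so that s can be absorbed into
     a and q below. *)
  exists (/ (1 + M))%R. assert (0 < / (1 + M))%R by (apply Rinv_0_lt_compat; lra).
  split; [assumption|]. rewrite norm_scalR. fold M. rewrite Rabs_pos_eq by nra.
  assert (/ (1 + M) * (1 + M) = 1)%R by (field; lra). nra. }
destruct Hs as (s & s_gt0 & Nt).
set (t := (s * s)%R *: (a * a - 1)) in *.
assert (St : ca_star t = t).
{ unfold t. now rewrite scalR_star, ca_starD, star_opp, star_one, ca_starM, Sa. }
assert (Cat : a * t = t * a).
{ unfold t. rewrite <- ca_scalMl, <- ca_scalMr. f_equal. non_commutative_ring. }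
destruct (exists_sqrt_one_sub A (t * t)) as (c & Sc & Ec & _ & Cc);
  [now apply star_square | now apply norm_square_le1|].
assert (Nc : (norm c <= 1)%R).
{ pose proof (norm_sq_le_sum_squares A c t Sc St) as H.
  rewrite Ec in H. replace (1 - t * t + t * t) with (1 : A) in H by non_commutative_ring.
  assert (H' : (norm c ^ 2 <= norm (1 : A))%R).
  { apply H. symmetry. apply Cc. now apply comm_square. }
  pose proof (norm_one_le1 A). pose proof (norm_ge0 A c). nra. }
(* Here p^2 = 1 - c^2 = t^2 and |1 - p| <= 1, so p is the absolute value of t; next, r is a square
   root of p. *)
destruct (exists_sqrt_one_sub A (c * c)) as (p & Sp & Ep & Np & Cp);
  [now apply star_square | now apply norm_square_le1|].
assert (Ept : p * p = t * t) by (rewrite Ep, Ec; non_commutative_ring).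
destruct (exists_sqrt_one_sub A (1 - p)) as (r & Sr & Er & _ & Cr);
  [now rewrite ca_starD, star_opp, star_one, Sp | exact Np |].
assert (Erp : r * r = p) by (rewrite Er; non_commutative_ring).
assert (Car : a * r = r * a).
(* Commutation with a passes from t through t^2, c, c^2, p and 1 - p to r. *)
{ apply Cr, comm_one_sub, Cp, comm_square, Cc, comm_square, Cat. }
destruct (exists_sqrt_one_sub B (f a * f a)) as (q & Sq & Eq & _ & Cq).
{ apply star_square. now rewrite <- fS, Sa. }
{ now apply norm_square_le1. }
assert (Erq : f r * q = q * f r).
{ apply Cq, comm_square. now rewrite <- !fM, Car. }
assert (Et : (s *: q) * (s *: q) = - f t).
{ rewrite scalR_mul, Eq. unfold t. rewrite fZ, fD, fM, arrow_opp, f1, <- scal_opp.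
  f_equal. non_commutative_ring. }
(* The two sides are f p and -f t; they have equal squares because p^2 = t^2, and both are squares
   of commuting self-adjoint elements. *)
assert (Efr : f r * f r = (s *: q) * (s *: q)).
{ apply square_inj_on_squares.
  - now rewrite <- fS, Sr.
  - now rewrite scalR_star, Sq.
  - now rewrite <- ca_scalMl, <- ca_scalMr, Erq.
  - rewrite Et, <- fM, Erp, <- fM, Ept, fM. non_commutative_ring. }
assert (Hp : p = - t).
{ apply fI. now rewrite arrow_opp, <- Et, <- Efr, <- fM, Erp. }
assert (H : (norm (s *: a) ^ 2 <= norm ((s *: a) * (s *: a) + r * r))%R).
{ apply norm_sq_le_sum_squares.
  - now rewrite scalR_star, Sa.
  - exact Sr.
  - now rewrite <- ca_scalMl, <- ca_scalMr, Car. }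
(* Now r^2 = p = s^2 (1 - a^2), so the sum of squares is constant and bounds |s a| by s. *)
assert (E1 : (s *: a) * (s *: a) + r * r = (s * s)%R *: 1).
{ rewrite scalR_mul, Erp, Hp. unfold t. rewrite <- scal_opp, <- ca_scalDr. f_equal.
  non_commutative_ring. }
rewrite E1, !norm_scalR, !Rabs_pos_eq in H by nra.
pose proof (norm_one_le1 A). pose proof (norm_ge0 A a).
assert (H2 : (s * s * norm a ^ 2 <= s * s * 1)%R) by nra.
apply Rmult_le_reg_l in H2; nra.
Qed.

(** The C*-identity reduces the claim to the self-adjoint element x* x. *)
Lemma arrow_norm_le1 x : (norm (f x) <= 1 <-> norm x <= 1)%R.
Proof.
assert (L : forall (D : CStarAlg) (z : D), (norm z <= 1 <-> norm (ca_star z * z) <= 1)%R).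
{ intros D z. rewrite ca_Cstar. pose proof (norm_ge0 D z). split; intros; nra. }
assert (S : ca_star (ca_star x * x) = ca_star x * x) by now rewrite ca_starM, ca_starK.
rewrite (L A), (L B), <- fS, <- fM.
split; [now apply selfadjoint_le1_of_arrow | now apply selfadjoint_arrow_le1].
Qed.

(** Rescaling extends the statement on unit balls to every positive radius; if the two norms
    differed, the radius halfway between them would give a contradiction. *)
Lemma arrow_isometry x : norm (f x) = norm x.
Proof.
assert (K : forall r : R, (0 < r)%R -> (norm (f x) <= r <-> norm x <= r)%R).
{ intros r Hr. pose proof (arrow_norm_le1 ((/ r)%R *: x)) as H.
  assert (0 < / r)%R by now apply Rinv_0_lt_compat.
  rewrite fZ, !norm_scalR, !Rabs_pos_eq in H by lra.
  assert (E : forall m, (/ r * m <= 1 <-> m <= r)%R).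
  { intros m. assert (r * (/ r * m) = m)%R by (field; lra). split; intros; nra. }
  now rewrite !E in H. }
pose proof (norm_ge0 A x). pose proof (norm_ge0 B (f x)).
apply Rle_antisym; apply Rnot_lt_le; intros L.
- assert (R0 : (0 < (norm x + norm (f x)) / 2)%R) by lra.
  pose proof (proj2 (K _ R0)). lra.
- assert (R0 : (0 < (norm x + norm (f x)) / 2)%R) by lra.
  pose proof (proj1 (K _ R0)). lra.
Qed.

Lemma arrow_range_subalgebra : is_CStar_subalgebra B (fun y => exists x, f x = y).
Proof.
repeat split.
- now exists 1.
- intros _ _ [x <-] [y <-]. exists (x + y). apply fD.
- intros _ _ [x <-] [y <-]. exists (x * y). apply fM.
- intros a _ [x <-]. exists (ca_scal a x). apply fZ.
- intros _ [x <-]. exists (ca_star x). apply fS.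
- intros u l Hu Hl.
  (* A chosen sequence of preimages is Cauchy by isometry; the image of its limit must be [l]. *)
  set (v n := proj1_sig (constructive_indefinite_description _ (Hu n))).
  assert (Hv : forall n, f (v n) = u n)
    by exact (fun n => proj2_sig (constructive_indefinite_description _ (Hu n))).
  assert (D : forall x y, norm (x - y) = norm (f x - f y)).
  { intros x y. now rewrite <- arrow_opp, <- fD, arrow_isometry. }
  destruct (ca_complete A v) as [m Hm].
  + intros eps He. destruct (Hl (eps / 2)%R ltac:(lra)) as [N HN]. exists N.
    intros i j Hi Hj. rewrite D, !Hv.
    replace (u i - u j) with ((u i - l) + (l - u j)) by non_commutative_ring.
    pose proof (ca_normD B (u i - l) (l - u j)) as T.
    rewrite (norm_subC B l) in T. pose proof (HN i Hi). pose proof (HN j Hj). lra.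
  + exists m. apply (converges_unique B u); [|exact Hl].
    intros eps He. destruct (Hm eps He) as [N HN]. exists N. intros n Hn.
    rewrite <- Hv, <- D. now apply HN.
Qed.

End Isometry.

(** * Restrictions of morphisms and the local algebras *)

Lemma morph_ext (K K' : CausalPoset) (g h : Morph K K') : (forall x, g x = h x) -> g = h.
Proof.
destruct g as [g ? ? ?], h as [h ? ? ?]; simpl; intros E.
assert (g = h) by now apply functional_extensionality. subst h.
f_equal; apply proof_irrelevance.
Qed.

(** The target [o'] is kept independent of [g o]: this covers inclusions, with [g] the identity, and
    inverses, where [t (s o) = o] holds only propositionally. *)
Definition restrict_m {K K' : CausalPoset} (g : Morph K K') (o : K) (o' : K')
  (H : forall a, cp_le a o -> cp_le (g a) o') : Morph (sub_cp K o) (sub_cp K' o').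
Proof.
refine {| mfun := fun x : sub_cp K o =>
            exist (fun b : K' => cp_le b o') (g (proj1_sig x)) (H _ (proj2_sig x))
            : sub_cp K' o' |}.
- intros [a Ha] [b Hb] E. apply (f_equal (@proj1_sig _ _)) in E; simpl in E.
  apply (m_inj _ _ g) in E. subst b. f_equal; apply proof_irrelevance.
- intros a b. apply (m_mono _ _ g).
- intros a b. apply (m_perp _ _ g).
Defined.

(** The restriction of g followed by the inclusion of (K'|o') equals the inclusion of (K|o) followed
    by g; apply F to this square. *)
Lemma local_alg_image (F : CausalFunctor) (K K' : CausalPoset) (g : Morph K K') (o : K) (o' : K') :
  (forall a, cp_le a o -> cp_le (g a) o') ->
  forall x, local_alg F K o x -> local_alg F K' o' (F_mor F g x).
Proof.
intros H _ [y <-]. exists (F_mor F (restrict_m g o o' H) y).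
rewrite <- !F_comp. f_equal. now apply morph_ext.
Qed.

Lemma local_alg_mono (F : CausalFunctor) (K : CausalPoset) (o a : K) :
  cp_le o a -> forall x, local_alg F K o x -> local_alg F K a x.
Proof.
intros H x Hx. rewrite <- (F_id F K x). apply (local_alg_image F K K (idm K) o a); [|exact Hx].
intros b Hb. exact (cp_trans K _ _ _ Hb H).
Qed.

Lemma local_alg_subalgebra (F : CausalFunctor) (K : CausalPoset) (o : K) :
  is_CStar_subalgebra (F K) (local_alg F K o).
Proof. apply arrow_range_subalgebra, F_arrow. Qed.

Theorem theorem2p5 (F : CausalFunctor) (K : CausalPoset) :
  (* (i) *)
  (forall o : K, is_CStar_subalgebra (F K) (local_alg F K o)) /\
  (forall o a : K, cp_le o a -> forall x, local_alg F K o x -> local_alg F K a x) /\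
  causal_subnet K (F K) (local_alg F K) /\
  (* (ii) *)
  (forall S : Morph K K -> Prop, symmetry_group K S ->
     (forall s, S s -> is_star_automorphism (F K) (F_mor F s)) /\
     (forall s, S s -> forall o : K,
        (forall x, local_alg F K o x -> local_alg F K (s o) (F_mor F s x)) /\
        (forall y, local_alg F K (s o) y ->
           exists x, local_alg F K o x /\ F_mor F s x = y)) /\
     (forall g h, S g -> S h -> forall (o : K) x, local_alg F K o x ->
        F_mor F g (F_mor F h x) = F_mor F (compm g h) x)).
Proof.
split; [exact (local_alg_subalgebra F K)|].
split; [exact (local_alg_mono F K)|].
split.
{ split; [exact (local_alg_subalgebra F K)|]. split; [exact (local_alg_mono F K)|].
  intros o1 o2 a _ _ Hperp _ _ [x <-] [y <-].
  (* The inclusions of (K|o1) and (K|o2) have ranges below o1 and o2, as the causality axiom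
     requires. *)
  apply (F_causal F K _ _ _ _ o1 o2 Hperp); intros b; exact (proj2_sig b). }
intros S (_ & _ & _ & Sinv).
assert (K1 : forall s t : Morph K K, (forall x, s (t x) = x) ->
          forall y, F_mor F s (F_mor F t y) = y).
{ intros s t Hst y. rewrite <- F_comp.
  rewrite (morph_ext _ _ (compm s t) (idm K) Hst). apply F_id. }
split; [|split].
- intros s Hs. destruct (Sinv s Hs) as (t & _ & Hst & _).
  destruct (F_arrow F K K s) as (HD & HM & HZ & HS & _ & HI).
  repeat split; try assumption.
  intros y. exists (F_mor F t y). now apply K1.
- intros s Hs o. destruct (Sinv s Hs) as (t & _ & Hst & Hts). split.
  + apply local_alg_image. intros a. apply (m_mono _ _ s).
  + intros y Hy. exists (F_mor F t y). split; [|now apply K1].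
    (* The inverse t carries the elements below s(o) to elements below t(s(o)) = o, so the preimage
       is local at o. *)
    apply (local_alg_image F K K t (s o) o); [|exact Hy].
    intros a Ha. rewrite <- (Hts o). now apply (m_mono _ _ t).
- intros g h _ _ o x _. symmetry. apply F_comp.
Qed.
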